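(* Let $a=\{a_j\}_{j\ge 1}$ be a positive, decreasing, summable sequence, and let $D_a\in\mathcal{C}_a$ be the decreasing rearrangement. Then $\dim_A D_a=0$ or $\dim_A D_a=1$. Moreover, $\dim_A D_a=0$ if and only if there is some $\varepsilon>0$ such that $a_j\ge \varepsilon\sum_{i=j+1}^{\infty}a_i$ for all $j$.
   Context: Decreasing means $a_j\ge a_{j+1}$ for all $j$. Let $L=\sum_j a_j$. The family $\mathcal{C}_a$ of complementary sets of $a$ consists of the closed subsets $E$ of $[0,L]$ of the form $E=[0,L]\setminus\bigcup_{j=1}^\infty U_j$, where $\{U_j\}$ is a disjoint family of open intervals contained in $[0,L]$ with the length of $U_j$ equal to $a_j$ for each $j$. The decreasing rearrangement is the countable set $D_a=\{0\}\cup\{\sum_{i=k}^\infty a_i: k\ge 1\}$, obtained by placing the gaps in order beginning at $L$. For non-empty $F\subset\mathbb{R}$, $N_r(F)$ denotes the minimum number of closed balls of radius $r$ needed to cover $F$, and $B(x,R)$ is the closed ball of radius $R$ centred at $x$. The Assouad dimension is $$\dim_A F=\inf\Bigl\{\alpha:\ \exists\, c,\rho>0 \text{ such that } \sup_{x\in F}N_r(B(x,R)\cap F)\le c\left(\tfrac{R}{r}\right)^{\alpha}\text{ for all }0<r<R<\rho\Bigr\}.$$ *)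

(* Defs.v *)
From HB Require Import structures.
From mathcomp Require Import all_boot all_order all_algebra.
From mathcomp Require Import all_classical all_reals all_analysis.
Set Implicit Arguments.
Unset Strict Implicit.
Unset Printing Implicit Defensive.
Import Order.TTheory GRing.Theory Num.Theory.
Import numFieldNormedType.Exports.
Local Open Scope classical_set_scope.
Local Open Scope ring_scope.

(* A sequence a_1, a_2, ... is indexed from 0: [a i] stands for a_(i+1).  Hence
   [tail a k] is the sum of the a_j over j >= k + 1, and [tail a 0] is the
   total length L. *)
Definition tail (R : realType) (a : R^nat) (k : nat) : R :=
  limn (fun n => \sum_(k <= i < n) a i).

Definition complementary_sets (R : realType) (a : R^nat) : set (set R) :=
  [set E | exists l u : R^nat,
    [/\ (forall j, u j - l j = a j),
        (forall j, [set` `]l j, u j[] `<=` [set` `[0, tail a 0]]),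
        trivIset setT (fun j => [set` `]l j, u j[]) &
        E = [set` `[0, tail a 0]] `\` \bigcup_j [set` `]l j, u j[] ] ].

Definition decreasing_rearrangement (R : realType) (a : R^nat) : set R :=
  0 |` range (tail a).

(* The minimum is taken in the extended reals: it is +oo when no finite cover
   exists, and otherwise it is attained, being over natural numbers.  The
   centres are arbitrary real numbers, not necessarily points of F. *)
Definition covering_number (R : realType) (r : R) (F : set R) : \bar R :=
  ereal_inf [set (size s)%:R%:E | s in
    [set s : seq R | F `<=` \bigcup_(x in [set` s]) closed_ball x r]].

(* The infimum is over real exponents and is +oo if there is no admissible
   one. *)
Definition assouad_dim (R : realType) (F : set R) : \bar R :=
  ereal_inf [set alpha%:E | alpha in [set alpha : R |
    exists c rho : R, [/\ 0 < c, 0 < rho &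
      forall r R0 : R, 0 < r -> r < R0 -> R0 < rho ->
        (ereal_sup [set covering_number r (closed_ball x R0 `&` F) | x in F]
          <= (c * (R0 / r) `^ alpha)%:E)%E]]].

Lemma tailE (R : realType) (a : R^nat) k :
  cvgn (series a) -> tail a k = limn (series a) - series a k.
Proof.
move=> a_cvg; apply/cvg_lim => //.
have : series a n - series a k @[n --> \oo] --> limn (series a) - series a k.
  by apply: cvgB => //; exact: cvg_cst.
apply: cvg_trans; apply: near_eq_cvg; near=> n.
have kn : (k <= n)%N by near: n; exact: nbhs_infty_ge.
by rewrite /series/= (big_cat_nat _ kn) //= [_ + \sum_(k <= _ < n) _]addrC addrK.
Unshelve. all: by end_near. Qed.

Lemma tailS (R : realType) (a : R^nat) k :
  cvgn (series a) -> tail a k = a k + tail a k.+1.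
Proof.
move=> a_cvg; rewrite !tailE// seriesSr opprD addrCA; congr (_ + _).
by rewrite [X in _ = X]addrC addrNK.
Qed.

Lemma tail_anti (R : realType) (a : R^nat) m n :
  (forall j, 0 < a j) -> cvgn (series a) -> (m <= n)%N -> tail a n <= tail a m.
Proof.
move=> a_gt0 a_cvg /subnK <-; elim: (n - m)%N => [//|d IH].
by rewrite addSn (le_trans _ IH)// [leRHS]tailS// lerDr ltW.
Qed.

Lemma tail_cvg0 (R : realType) (a : R^nat) :
  cvgn (series a) -> tail a @ \oo --> (0 : R).
Proof.
move=> a_cvg.
rewrite (_ : tail a = fun k => limn (series a) - series a k); last first.
  by apply/funext => k; rewrite tailE.
rewrite -[X in _ --> X](subrr (limn (series a))).
by apply: cvgB => //; exact: cvg_cst.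
Qed.

Lemma tail_ge0 (R : realType) (a : R^nat) k :
  (forall j, 0 < a j) -> cvgn (series a) -> 0 <= tail a k.
Proof.
move=> a_gt0 a_cvg; rewrite -(cvg_lim _ (tail_cvg0 a_cvg))//.
apply: limr_le; first by apply/cvg_ex; exists 0; exact: tail_cvg0.
by near=> n; apply: tail_anti => //; near: n; exact: nbhs_infty_ge.
Unshelve. all: by end_near. Qed.

Lemma decreasing_rearrangement_complementary (R : realType) (a : R^nat) :
  (forall j, 0 < a j) -> cvgn (series a) ->
  complementary_sets a (decreasing_rearrangement a).
Proof.
move=> a_gt0 a_cvg.
have ge0 k : 0 <= tail a k by exact: tail_ge0.
have anti m n : (m <= n)%N -> tail a n <= tail a m by exact: tail_anti.
exists (fun j => tail a j.+1), (tail a); split.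
- by move=> j; rewrite (tailS j)// addrK.
- move=> j x /=; rewrite !in_itv/= => /andP[lx xu].
  by rewrite (le_trans (ge0 j.+1) (ltW lx)) (le_trans (ltW xu))// anti.
- apply/trivIsetP => m n _ _; wlog mn : m n / (m < n)%N => [W|_].
    rewrite neq_ltn => /orP[mn|nm]; first by apply: W => //; rewrite neq_ltn mn.
    by rewrite setIC; apply: W => //; rewrite neq_ltn nm.
  rewrite -subset0 => x [] /=; rewrite !in_itv/= => /andP[x1 _] /andP[_ x2].
  by have := lt_trans x1 x2; rewrite ltNge anti.
- apply/seteqP; split => x.
  + move=> [->|[k _ <-]] /=.
      split; first by rewrite /= in_itv/= lexx ge0.
      by move=> [j _] /=; rewrite in_itv/= => /andP[]; rewrite ltNge ge0.
    split; first by rewrite /= in_itv/= ge0 anti.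
    move=> [j _] /=; rewrite in_itv/= => /andP[x1 x2].
    have [kj|jk] := leqP k j; first by move: x2; rewrite ltNge anti.
    by move: x1; rewrite ltNge anti.
  + rewrite /= in_itv/= => -[/andP[x0 xL] xU].
    have [->|xn0] := eqVneq x 0; first by left.
    right; have {xn0}x0 : 0 < x by rewrite lt_neqAle eq_sym xn0.
    have [N Nx] : exists N, tail a N <= x.
      have /cvgr_lt/(_ _ x0)[N _ HN] := tail_cvg0 a_cvg.
      by exists N; apply/ltW/HN => /=.
    have exN : exists N, tail a N <= x by exists N.
    case: (ex_minnP exN) => -[|m] mx mmin.
      by exists 0%N => //; apply/eqP; rewrite eq_le mx xL.
    exists m.+1 => //; apply/eqP; rewrite eq_le mx leNgt; apply/negP => mx'.
    apply: xU; exists m => //=; rewrite in_itv/= mx' ltNge.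
    by apply/negP => /mmin; rewrite ltnn.
Qed.

(* Main.v *)
Require Import Defs.
From mathcomp Require Import all_boot all_order all_algebra.
From mathcomp Require Import all_classical all_reals all_analysis.
From mathcomp Require Import lra.
Set Implicit Arguments.
Unset Strict Implicit.
Import Order.TTheory GRing.Theory Num.Theory.
Import numFieldNormedType.Exports.
Local Open Scope classical_set_scope.
Local Open Scope ring_scope.

(** The points of D_a are 0 and the tails t_k of the series, so D_a is a sequence
    decreasing to 0 whose consecutive gaps are the a_k.  Every non-empty subset
    of the line has dimension between 0 and 1 ([assouad_dim_ge0],
    [assouad_dim_le1]); what has to be shown is that the two sides of the
    criterion force the two extreme values.

    If a_j >= eps t_(j+1) for all j, then t_j >= (1 + eps) t_(j+1): the points
    decay at least geometrically.  Away from a neighbourhood of size r of the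
    origin, a ball of radius R then contains only O(log (R / r)) of them
    ([ball_cover_geometric]), which is O((R / r)^alpha) for every alpha > 0, so
    the dimension is 0 ([assouad_dim_geometric]).

    If no eps works, then for every eps some j has a_j < eps t_(j+1).  As a is
    decreasing, all later gaps are at most a_j too, so at scale r = eps t_(j+1)
    the set D_a is indistinguishable from the whole interval [0, t_(j+1)]
    ([rearrangement_dense]).  Hence covering its part of radius R = t_(j+1)
    takes at least R / (4 r) balls of radius r ([rearrangement_cover_size]),
    where R / r = 1 / eps is as large as desired; no exponent alpha < 1 can
    bound this ([assouad_dim_not_geometric]).  A small eps also forces j to be
    large, because finitely many indices have a positive minimal ratio
    a_j / t_(j+1); so R can be made smaller than any prescribed rho. *)

(** * Bounding the Assouad dimension by explicit covers *)

Definition ball_cover (R : realType) (r : R) (s : seq R) (F : set R) :=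
  F `<=` \bigcup_(y in [set` s]) closed_ball y r.

Lemma in_closed_ball (R : realType) (x y r : R) :
  0 < r -> closed_ball x r y <-> `|x - y| <= r.
Proof. by move=> r0; rewrite closed_ballE. Qed.

Lemma assouad_dim_le (R : realType) (F : set R) (alpha c : R) :
  0 < c ->
  (forall x r R0, F x -> 0 < r -> r < R0 ->
    exists2 s, ball_cover r s (closed_ball x R0 `&` F) &
      (size s)%:R <= c * (R0 / r) `^ alpha) ->
  (assouad_dim F <= alpha%:E)%E.
Proof.
move=> c0 cover; apply: ereal_inf_lbound; exists alpha => //.
exists c, 1; split=> // r R0 r0 rR0 _.
apply: ge_ereal_sup => _ [x Fx <-]; have [s sF sc] := cover x r R0 Fx r0 rR0.
apply: (@le_trans _ _ (size s)%:R%:E); last by rewrite lee_fin.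
by apply: ereal_inf_lbound; exists s.
Qed.

(** For alpha < beta, a bound by c (R0 / r)^alpha contradicts growth of order
    (R0 / r)^beta as soon as (R0 / r)^(beta - alpha) > c / kappa.  It is
    therefore enough that the lower bound holds along configurations with
    arbitrarily small R0 and arbitrarily large ratio R0 / r. *)
Lemma assouad_dim_ge (R : realType) (F : set R) (beta kappa : R) :
  0 < kappa ->
  (forall M rho, 0 < rho -> exists x r R0,
    [/\ F x, 0 < r, r < R0, R0 < rho & M < R0 / r] /\
    forall s, ball_cover r s (closed_ball x R0 `&` F) ->
      kappa * (R0 / r) `^ beta <= (size s)%:R) ->
  (beta%:E <= assouad_dim F)%E.
Proof.
move=> kappa0 H; apply: le_ereal_inf_tmp => _ [alpha [c [rho [c0 rho0 Hc]]] <-].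
rewrite lee_fin leNgt; apply/negP => alpha_beta.
set d := beta - alpha; have d0 : 0 < d by rewrite subr_gt0.
have [x [r [R0 [[Fx r0 rR0 R0rho MQ] Hs]]]] := H ((c / kappa) `^ d^-1) rho rho0.
set Q := R0 / r in MQ Hs; have Q0 : 0 < Q by rewrite divr_gt0// (lt_trans r0).
have : ((kappa * Q `^ beta)%:E <= (c * Q `^ alpha)%:E)%E.
  apply: le_trans (Hc r R0 r0 rR0 R0rho).
  apply: (@le_trans _ _ (covering_number r (closed_ball x R0 `&` F))); last first.
    by apply: ereal_sup_ubound; exists x.
  by apply: le_ereal_inf_tmp => _ [s sF <-]; rewrite lee_fin; exact: Hs.
apply/negP; rewrite lee_fin -ltNge.
have -> : beta = d + alpha by rewrite /d subrK.
rewrite powRD; last by rewrite (gt_eqF Q0) implybT.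
rewrite mulrA ltr_pM2r ?powR_gt0// mulrC -ltr_pdivrMr//.
have : ((c / kappa) `^ d^-1) `^ d < Q `^ d.
  by rewrite gt0_ltr_powR// nnegrE ?powR_ge0// ltW.
by rewrite -powRrM mulVf ?gt_eqF// powRr1// ltW// divr_gt0.
Qed.

(** A cover of a non-empty set has at least one ball, whatever the ratio of the
    radii; this excludes negative exponents. *)
Lemma assouad_dim_ge0 (R : realType) (F : set R) :
  F !=set0 -> (0 <= assouad_dim F)%E.
Proof.
move=> [x Fx]; apply: (@assouad_dim_ge _ _ 0 1) => // M rho rho0.
set Q := `|M| + 2; have Q2 : 2 <= Q by rewrite lerDr.
have Q0 : 0 < Q by lra.
exists x, (rho / 2 / Q), (rho / 2); split.
  split=> //.
  - by rewrite !divr_gt0.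
  - rewrite ltr_pdivrMr//; nra.
  - lra.
  - rewrite invf_div mulrC divfK; last by lra.
    by rewrite (le_lt_trans (ler_norm M))// /Q; lra.
move=> s sF; rewrite powRr0 mulr1 ler1n lt0n size_eq0; apply/eqP => s0.
have [|y] := sF x; last by rewrite s0.
by split=> //; apply/in_closed_ball; rewrite ?subrr ?normr0; lra.
Qed.

(** An interval of length 2 R0 is covered by at most R0 / r + 1 <= 2 (R0 / r)
    consecutive intervals of length 2 r. *)
Lemma assouad_dim_le1 (R : realType) (F : set R) : (assouad_dim F <= 1)%E.
Proof.
apply: (@assouad_dim_le _ _ 1 2) => // x r R0 _ r0 rR0.
have Q1 : 1 < R0 / r by rewrite ltr_pdivlMr// mul1r.
set n := (Num.trunc (R0 / r)).+1.
have nQ : n%:R <= R0 / r + 1.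
  by rewrite /n -natr1 lerD2r truncn_le; lra.
exists [seq x - R0 + (2 * i%:R + 1) * r | i <- iota 0 n]; last first.
  by rewrite size_map size_iota powRr1; lra.
move=> y [/in_closed_ball - /(_ (lt_trans r0 rR0)) xy _].
have /andP[y1 y2] : (x - R0 <= y <= x + R0) by move: xy; rewrite ler_norml; lra.
(* z is the abscissa of y in units of 2 r from the left end of the interval;
   its integer part designates the ball containing y. *)
set z := (y - (x - R0)) / (2 * r).
have z0 : 0 <= z by rewrite divr_ge0; lra.
have zE : y = x - R0 + z * (2 * r) by rewrite /z divfK ?subrKC; lra.
have /andP[i1 i2] := truncn_itv z0; set i := Num.trunc z in i1 i2.
exists (x - R0 + (2 * i%:R + 1) * r).
  apply/mapP; exists i => //; rewrite mem_iota/= add0n /n ltnS.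
  apply: le_truncn; rewrite /z ler_pdivrMr ?mulr_gt0// mulrCA divfK; lra.
apply/in_closed_ball => //; rewrite zE -natr1 ler_norml in i2 *.
by apply/andP; split; nra.
Qed.

(** Subadditivity of Lebesgue measure. *)
Lemma ball_cover_length (R : realType) (l u r : R) (s : seq R) :
  0 < r -> ball_cover r s [set` `[l, u]] -> u - l <= (size s)%:R * (2 * r).
Proof.
move=> r0; rewrite /ball_cover bigcup_seq => sub.
have [ul|lu] := leP u l.
  by rewrite (@le_trans _ _ 0) ?subr_le0// !mulr_ge0// ltW.
have mB (t : seq R) : measurable (\big[setU/set0]_(y <- t) closed_ball y r).
  by apply: bigsetU_measurable => y _; exact: measurable_realfun.measurable_closed_ball.
have le_mu (t : seq R) :
    (lebesgue_measure (\big[setU/set0]_(y <- t) closed_ball y r) <=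
      ((size t)%:R * (2 * r))%:E)%E.
  elim: t => [|y t IH]; first by rewrite big_nil measure0 mul0r.
  rewrite big_cons; apply: le_trans (measureU2 _ _ _) _.
  - exact: measurable_realfun.measurable_closed_ball.
  - exact: mB.
  rewrite /= -natr1 mulrDl mul1r addrC EFinD leeD//.
  by rewrite lebesgue_measure_closed_ball ?lee_fin ?mulr_natl // ltW.
have muI : lebesgue_measure [set` `[l, u]] = (u - l)%:E.
  by rewrite lebesgue_measure_itv/= lte_fin lu -EFinB.
rewrite -lee_fin -muI (le_trans _ (le_mu s))//.
apply: le_measure => //; rewrite inE; last exact: mB.
exact: measurable_itv.
Qed.

(** * Logarithmic growth is slower than any power *)

Lemma bernoulli_ineq (R : realType) (p : R) n :
  1 <= p -> n%:R * (p - 1) <= p ^+ n.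
Proof.
move=> p1; suff : 1 + n%:R * (p - 1) <= p ^+ n by lra.
elim: n => [|n IH]; first by rewrite mul0r addr0.
rewrite exprS -natr1; have p0 : 0 <= p by lra.
have := ler_wpM2l p0 IH.
have : 0 <= n%:R * (p - 1) ^+ 2 by rewrite mulr_ge0// sqr_ge0.
lra.
Qed.

Lemma powR_gt1 (R : realType) (q alpha : R) :
  1 < q -> 0 < alpha -> 1 < q `^ alpha.
Proof.
move=> q1 alpha0; have : 1 `^ alpha < q `^ alpha.
  by rewrite gt0_ltr_powR// nnegrE; lra.
by rewrite powR1.
Qed.

(** This is n = O(log Q) turned into n = O(Q^alpha) without logarithms: apply
    Bernoulli's inequality with base q^alpha in place of q. *)
Lemma le_powR_of_expr_le (R : realType) (q Q alpha : R) n :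
  1 < q -> 0 < alpha -> q ^+ n <= Q -> n%:R <= (q `^ alpha - 1)^-1 * Q `^ alpha.
Proof.
move=> q1 alpha0 qQ; have q0 : 0 <= q by lra.
have p1 := powR_gt1 q1 alpha0.
rewrite mulrC ler_pdivlMr ?subr_gt0//.
apply: (le_trans (bernoulli_ineq n (ltW p1))).
rewrite -powR_mulrn ?powR_ge0// powRAC powR_mulrn//.
have qn0 : 0 <= q ^+ n by rewrite exprn_ge0.
by rewrite ge0_ler_powR ?nnegrE ?(le_trans qn0 qQ)// ltW.
Qed.

(** * The set of tails of a positive summable sequence *)

Section tails.
Context (R : realType) (a : R^nat).
Hypotheses (a_pos : forall j, 0 < a j) (a_summable : cvgn (series a)).
Local Notation t := (tail a).
Local Notation D := (decreasing_rearrangement a).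

Lemma tail_gt0 k : 0 < t k.
Proof. by rewrite tailS// ltr_pwDl// tail_ge0. Qed.

Lemma ex_tail_lt (x : R) : 0 < x -> exists k, t k < x.
Proof.
move=> x0; have /cvgr_lt/(_ _ x0)[N _ HN] := tail_cvg0 a_summable.
by exists N; apply: HN => /=.
Qed.

Lemma tail_ratio (q : R) : 0 <= q -> (forall j, q * t j.+1 <= t j) ->
  forall m n, q ^+ n * t (m + n)%N <= t m.
Proof.
move=> q0 H m; elim=> [|n IH]; first by rewrite mul1r addn0.
by rewrite (le_trans _ IH)// exprSr -mulrA ler_wpM2l ?exprn_ge0// addnS.
Qed.

(** One ball centred at 0 absorbs the points below r.  The points of the set
    between w = max (x - R0) r and x + R0 are covered one by one, and
    (x + R0) / w <= 3 R0 / r in all cases: if x <= 2 R0, because x + R0 <= 3 R0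
    and w >= r; if x > 2 R0, because x + R0 <= 3 (x - R0).  By geometric decay,
    the number of these points is controlled by this ratio.  The exponent n is
    one less than that number (if there are any), since n + 1 points only span
    n ratios. *)
Lemma ball_cover_geometric (q x r R0 : R) : 1 < q ->
  (forall j, q * t j.+1 <= t j) -> D x -> 0 < r -> r < R0 ->
  exists n, q ^+ n <= 3 * (R0 / r) /\
    exists2 s, ball_cover r s (closed_ball x R0 `&` D) & (size s <= n.+2)%N.
Proof.
move=> q1 Hq Dx r0 rR0; have R00 : 0 < R0 by lra.
have x0 : 0 <= x by case: Dx => [->//|[k _ <-]]; exact: tail_ge0.
have Q1 : 1 < R0 / r by rewrite ltr_pdivlMr// mul1r.
set w := Num.max (x - R0) r.
have w0 : 0 < w by rewrite lt_max r0 orbT.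
have xw : x + R0 <= 3 * (R0 / r) * w.
  have [xR|xR] := leP x (2 * R0).
    rewrite (@le_trans _ _ (3 * (R0 / r) * r))//.
      by rewrite -mulrA divfK; lra.
    by rewrite ler_wpM2l ?le_max ?lexx ?orbT//; lra.
  rewrite (@le_trans _ _ (3 * (R0 / r) * (x - R0)))//; first nra.
  by rewrite ler_wpM2l ?le_max ?lexx//; lra.
have [m0 Hm0] : exists k, t k < x + R0 by apply: ex_tail_lt; lra.
have exm : exists m, t m <= x + R0 by exists m0; exact: ltW.
(* t m is the largest tail that is at most x + R0; t (m + n) is the first one
   below w, so that exactly n tails have to be covered individually. *)
case: (ex_minnP exm) => m tm mmin.
have exn : exists n, t (m + n)%N < w.
  have [N HN] := ex_tail_lt w0; exists N.
  by rewrite (le_lt_trans _ HN)// tail_anti// leq_addl.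
case: (ex_minnP exn) => n tn nmin.
have cover : ball_cover r (0 :: [seq t k | k <- iota m n]) (closed_ball x R0 `&` D).
  move=> y [/in_closed_ball - /(_ R00)].
  rewrite ler_norml => /andP[y1 y2] [->|[k _ yE]].
    by exists 0; [rewrite /= mem_head|apply/in_closed_ball; rewrite ?subrr ?normr0 ?ltW].
  have mk : (m <= k)%N by apply: mmin; rewrite yE; lra.
  have [kn|nk] := ltnP k (m + n).
    exists y; last by apply/in_closed_ball; rewrite ?subrr ?normr0 ?ltW.
    by rewrite /= inE -yE map_f ?orbT// mem_iota mk.
  exists 0; first by rewrite /= mem_head.
  have yw : y < w by rewrite (le_lt_trans _ tn)// -yE tail_anti.
  have yr : y < r by move: yw; rewrite lt_max => /orP[]//; lra.
  have y0 : 0 <= y by rewrite -yE tail_ge0.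
  by apply/in_closed_ball => //; rewrite sub0r normrN ger0_norm// ltW.
exists n.-1; split; last first.
  by exists (0 :: [seq t k | k <- iota m n]) => //; rewrite /= size_map size_iota; case: (n).
case: n tn nmin {cover} => [|n] _ nmin; first by rewrite expr0; lra.
have wt : w <= t (m + n)%N.
  by rewrite leNgt; apply/negP => /nmin; rewrite ltnn.
rewrite -(ler_pM2r w0) (le_trans _ xw)// (le_trans _ tm)//.
rewrite (le_trans _ (tail_ratio _ Hq m n)) ?ler_wpM2l ?exprn_ge0//; lra.
Qed.

(** A geometrically decaying set has at most n + 2 = O((R0 / r)^alpha) covering
    balls for each alpha > 0, so that no positive number bounds its dimension
    from below. *)
Lemma assouad_dim_geometric (eps : R) : 0 < eps ->
  (forall j, eps * t j.+1 <= a j) -> (assouad_dim D <= 0)%E.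
Proof.
move=> eps0 Heps; set q := 1 + eps; have q1 : 1 < q by rewrite ltrDl.
have Hq j : q * t j.+1 <= t j by rewrite (tailS j)// mulrDl mul1r addrC lerD2r.
apply/lee_addgt0Pr => alpha alpha0; rewrite add0e.
have p1 := powR_gt1 q1 alpha0.
set C := (q `^ alpha - 1)^-1; have C0 : 0 < C by rewrite invr_gt0 subr_gt0.
have P0 : 0 < 3 `^ alpha :> R by rewrite powR_gt0.
apply: (@assouad_dim_le _ _ _ (C * 3 `^ alpha + 2)) => [|x r R0 Dx r0 rR0].
  by rewrite addr_gt0// mulr_gt0.
have [n [qn [s sD sn]]] := ball_cover_geometric q1 Hq Dx r0 rR0.
exists s => //; apply: (@le_trans _ _ n.+2%:R); first by rewrite ler_nat.
have := le_powR_of_expr_le q1 alpha0 qn; rewrite -/C.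
have Q1 : 1 < R0 / r by rewrite ltr_pdivlMr// mul1r.
rewrite powRM; [|lra|lra].
have QP : 1 <= (R0 / r) `^ alpha by rewrite -(powRr0 (R0 / r)) ler_powR ?ltW.
by rewrite -addn2 natrD mulrDl mulrA => nC; nra.
Qed.

Hypothesis a_decr : forall j, a j.+1 <= a j.

Lemma le_decr m n : (m <= n)%N -> a n <= a m.
Proof. by move=> mn; have /nonincreasing_seqP := a_decr; exact. Qed.

(** Below t k all gaps have an index at least k, hence, a being
    decreasing, a length at most a k. *)
Lemma rearrangement_dense k (y : R) :
  0 <= y -> y <= t k -> exists2 z, D z & z <= y <= z + a k.
Proof.
rewrite le_eqVlt => /predU1P[<- _|y0 yk].
  by exists 0; [left|rewrite lexx add0r ltW].
have [N HN] := ex_tail_lt y0.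
have exn : exists n, t (k + n)%N <= y.
  by exists N; rewrite (le_trans _ (ltW HN))// tail_anti// leq_addl.
case: (ex_minnP exn) => -[|n] tn nmin.
  rewrite addn0 in tn; exists (t k); first by right; exists k.
  by rewrite tn (le_trans yk)// lerDl ltW.
exists (t (k + n.+1)%N); first by right; exists (k + n.+1)%N.
rewrite tn/= addnS (@le_trans _ _ (t (k + n)%N))//.
  by rewrite leNgt; apply/negP => /ltW/nmin; rewrite ltnn.
by rewrite (tailS (k + n))// addrC lerD2l le_decr// leq_addr.
Qed.

(** Doubling the radius of the balls absorbs the gaps, so that they cover the
    whole interval [0, t k]; then compare lengths. *)
Lemma rearrangement_cover_size k (r : R) s : 0 < r -> a k <= r ->
  ball_cover r s (closed_ball 0 (t k) `&` D) -> t k <= (size s)%:R * (4 * r).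
Proof.
move=> r0 ar sD; have tk0 := tail_gt0 k.
have : ball_cover (2 * r) s [set` `[0, t k]].
  move=> y /=; rewrite in_itv/= => /andP[y0 yk].
  have [z Dz /andP[zy yz]] := rearrangement_dense y0 yk.
  have z0 : 0 <= z by case: Dz => [->//|[i _ <-]]; exact: tail_ge0.
  have [|x sx /in_closed_ball - /(_ r0)] := sD z.
    split=> //; apply/in_closed_ball => //.
    by rewrite sub0r normrN ger0_norm//; lra.
  rewrite ler_norml => /andP[x1 x2]; exists x => //.
  by apply/in_closed_ball; rewrite ?ler_norml ?mulr_gt0//; lra.
have r20 : 0 < 2 * r by rewrite mulr_gt0.
by move=> /(ball_cover_length r20); lra.
Qed.

(** Apply [assouad_dim_ge] at x = 0 with R0 = t j.+1 and r = eps * t j.+1, where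
    j is an index at which the ratio condition fails for a small eps. *)
Lemma assouad_dim_not_geometric :
  ~ (exists eps, 0 < eps /\ forall j, eps * t j.+1 <= a j) ->
  (1 <= assouad_dim D)%E.
Proof.
move=> H; apply: (@assouad_dim_ge _ _ 1 (4^-1)) => [|M rho rho0].
  by rewrite invr_gt0.
have [J tJ] := ex_tail_lt rho0.
have t00 := tail_gt0 0.
(* The bound eps * t 0 <= a J rules out every j <= J, as a is decreasing; hence
   t j.+1 <= t J < rho.  The last two bounds control R0 / r = eps^-1. *)
have [eps [eps0 epsJ eps1 epsM]] : exists eps : R,
    [/\ 0 < eps, eps * t 0%N <= a J, eps < 1 & M < eps^-1].
  have B0 : 0 < `|M| + 2 by rewrite ltr_wpDl.
  exists (Num.min (a J / t 0%N) (`|M| + 2)^-1); split.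
  - by rewrite lt_min divr_gt0//= invr_gt0.
  - by rewrite -ler_pdivlMr// ge_min lexx.
  - by rewrite gt_min invf_lt1// orbC ltr_wpDl// ltr1n.
  - rewrite (le_lt_trans (ler_norm M))// (@lt_le_trans _ _ (`|M| + 2))//.
      by rewrite ltrDl.
    rewrite -[leLHS]invrK lef_pV2 ?posrE ?invr_gt0//.
      by rewrite ge_min lexx orbT.
    by rewrite lt_min divr_gt0//= invr_gt0.
have [j aj] : exists j, a j < eps * t j.+1.
  apply: contrapT => /forallNP Hj; apply: H; exists eps; split=> // j.
  by rewrite leNgt; apply/negP/Hj.
have Jj : (J < j)%N.
  rewrite ltnNge; apply/negP => jJ; have := le_decr jJ.
  have := @tail_anti _ a 0%N j.+1 a_pos a_summable (leq0n _); nra.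
have tj0 := tail_gt0 j.+1.
have QE : t j.+1 / (eps * t j.+1) = eps^-1.
  by rewrite invfM mulrCA divff ?mulr1// gt_eqF.
exists 0, (eps * t j.+1), (t j.+1); rewrite QE; split.
  split=> //; first by left.
  - by rewrite mulr_gt0.
  - by rewrite gtr_pMl.
  - by rewrite (le_lt_trans _ tJ)// tail_anti// ltnW// ltnS ltnW.
move=> s /rearrangement_cover_size; rewrite mulr_gt0// => /(_ isT).
move=> /(_ (le_trans (a_decr j) (ltW aj))).
move=> sz; rewrite powRr1; last by rewrite invr_ge0 ltW.
rewrite -invfM -[leLHS]mul1r ler_pdivrMr ?mulr_gt0// -(ler_pM2r tj0) mul1r.
by rewrite (le_trans sz)// !mulrA lexx.
Qed.
End tails.

Unset Implicit Arguments.
Set Strict Implicit.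

Theorem proposition4 (R : realType) (a : R^nat)
  (a_pos : forall j : nat, 0 < a j)
  (a_decr : forall j : nat, a j.+1 <= a j)
  (a_summable : cvgn (series a)) :
  (assouad_dim (decreasing_rearrangement a) = 0%:E \/
   assouad_dim (decreasing_rearrangement a) = 1%:E) /\
  (assouad_dim (decreasing_rearrangement a) = 0%:E <->
   exists eps : R, 0 < eps /\ forall j : nat, eps * tail a j.+1 <= a j).
Proof.
have D0 : decreasing_rearrangement a !=set0 by exists 0; left.
have [H|H] :=
  pselect (exists eps : R, 0 < eps /\ forall j : nat, eps * tail a j.+1 <= a j).
  suff -> : assouad_dim (decreasing_rearrangement a) = 0%:E by split=> //; left.
  have [eps [eps0 Heps]] := H.
  by apply/eqP; rewrite eq_le assouad_dim_ge0// (assouad_dim_geometric a_pos a_summable eps0).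
suff -> : assouad_dim (decreasing_rearrangement a) = 1%:E.
  split; first by right.
  by split=> // -[] /eqP; rewrite oner_eq0.
by apply/eqP; rewrite eq_le assouad_dim_le1 assouad_dim_not_geometric.
Qed.
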